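(* Let $n>1$ be a positive integer. Then: (i) $n \in \mathbb{G}$ if and only if $n$ is composite and $n\in \mathfrak{S}_{-1}$. (ii) $n \in \mathbb{W}$ if and only if $n\in \mathfrak{S}_{1}$. In other words, $\mathfrak{S}_{1} = \mathbb{W}$ and $\mathfrak{S}_{-1} = \{1\} \cup \mathbb{P} \cup \mathbb{G}$.
   Context: For an integer $\mu$, a $\mu$-Sondow number is a positive integer $n$ such that $p^{\nu_p(n)} \mid (n/p +\mu)$ for every prime $p \mid n$, where $\nu_p(n)=\max\{s:p^s\mid n\}$; $\mathfrak{S}_\mu$ is the set of all $\mu$-Sondow numbers. A Giuga number is a composite (positive) integer $n$ such that $p\mid (n/p-1)$ for every prime divisor $p$ of $n$; $\mathbb{G}$ is the set of Giuga numbers. A weak primary pseudoperfect number is a positive integer $n$ such that $\frac{1}{n}+\sum_{p \mid n}\frac{1}{p} \in \mathbb{N}$, the sum being over the distinct prime divisors of $n$ and $\mathbb{N}=\{1,2,3,\dots\}$; $\mathbb{W}$ is the set of weak primary pseudoperfect numbers. $\mathbb{P}$ is the set of prime numbers. *)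

(* Defs.v *)
From HB Require Import structures.
From mathcomp Require Import all_boot all_order all_algebra.
From mathcomp Require Import boolp classical_sets.

Set Implicit Arguments.
Unset Strict Implicit.
Unset Printing Implicit Defensive.

Import Order.TTheory GRing.Theory Num.Theory.
Local Open Scope ring_scope.

(* The quotient n / p is exact, as p %| n; adding mu is done in int, so that
   negative values of mu are not affected by truncated subtraction. *)
Definition sondow (mu : int) : set nat :=
  [set n | (0 < n)%N /\
     forall p : nat, prime p -> (p %| n)%N ->
       ((p ^ logn p n)%N%:Z %| (n %/ p)%N%:Z + mu)%Z]%classic.

Definition composite (n : nat) : Prop := (1 < n)%N /\ ~~ prime n.

Definition giuga : set nat :=
  [set n | composite n /\
     forall p : nat, prime p -> (p %| n)%N ->
       (p%:Z %| (n %/ p)%N%:Z - 1)%Z]%classic.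

Definition weak_primary_pseudoperfect : set nat :=
  [set n | (0 < n)%N /\
     exists2 k : nat, (0 < k)%N &
       n%:R^-1 + \sum_(p <- primes n) p%:R^-1 = k%:R :> rat]%classic.

Definition prime_numbers : set nat := [set p | prime p]%classic.

(* Main.v *)
(* For q <> p the full p-part of n divides n/q, so modulo that p-part the sum
   1 + sum_(q | n) n/q reduces to 1 + n/p. Hence n is a 1-Sondow number iff
   n divides this sum, that is, iff 1/n + sum 1/q is an integer. For
   mu = -1, the condition p | n/p - 1 already forces p^2 not to divide n,
   so the Giuga and Sondow conditions coincide. *)
Require Import Defs.
From HB Require Import structures.
From mathcomp Require Import all_boot all_order all_algebra.
From mathcomp Require Import boolp classical_sets.

Set Implicit Arguments.
Unset Strict Implicit.
Unset Printing Implicit Defensive.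

Import Order.TTheory GRing.Theory Num.Theory.
Local Open Scope ring_scope.

(** The [p]-part of [n] divides [n = (n %/ q) * q] and is coprime to [q], so Gauss's lemma
    applies. *)
Lemma dvdn_part_div_prime (n p q : nat) :
  prime p -> prime q -> (q %| n)%N -> q != p -> (n`_p %| n %/ q)%N.
Proof.
move=> p_pr q_pr q_n qp.
have cop : coprime n`_p q.
  rewrite p_part; apply: coprimeXl.
  by rewrite prime_coprime // dvdn_prime2 // eq_sym.
by rewrite -(Gauss_dvdl _ cop) divnK // dvdn_part.
Qed.

Lemma dvdn_part_sum_div_primes (n p : nat) : (0 < n)%N -> prime p -> (p %| n)%N ->
  (n`_p %| 1 + \sum_(q <- primes n) n %/ q)%N = (n`_p %| n %/ p + 1)%N.
Proof.
move=> n_gt0 p_pr p_n.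
have p_in : p \in primes n by rewrite mem_primes p_pr n_gt0.
rewrite (bigD1_seq p) ?primes_uniq //= addnA addnC dvdn_addr 1?addnC //.
rewrite big_seq_cond; apply: dvdn_sum => q /andP[].
by rewrite mem_primes => /and3P[q_pr _ q_n]; apply: dvdn_part_div_prime.
Qed.

(** Divisibility by [n] can be tested on its [p]-parts, one prime divisor at a time. *)
Lemma sondow1_dvdn (n : nat) :
  sondow 1 n <-> (0 < n)%N /\ (n %| 1 + \sum_(p <- primes n) n %/ p)%N.
Proof.
split=> -[n_gt0 H]; split=> //.
  apply/dvdn_partP => // p; rewrite mem_primes => /and3P[p_pr _ p_n].
  by rewrite dvdn_part_sum_div_primes // p_part; apply: H.
move=> p p_pr p_n.
(* As [mu = 1] is nonnegative, the divisibility in [int] computes to this one in [nat]. *)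
suff: (p ^ logn p n %| n %/ p + 1)%N by [].
rewrite -p_part -dvdn_part_sum_div_primes //.
exact: dvdn_trans (dvdn_part _ _) H.
Qed.

(** Over the common denominator [n], the sum of reciprocals is [s / n]. *)
Lemma weak_primary_pseudoperfect_dvdn (n : nat) :
  weak_primary_pseudoperfect n <->
  (0 < n)%N /\ (n %| 1 + \sum_(p <- primes n) n %/ p)%N.
Proof.
set s := (1 + _)%N.
suff sE : (0 < n)%N ->
    n%:R^-1 + \sum_(p <- primes n) p%:R^-1 = s%:R / n%:R :> rat.
  split=> -[n_gt0].
    have n_neq0 : n%:R != 0 :> rat by rewrite pnatr_eq0 -lt0n.
    case=> k _; rewrite sE // => /(canRL (divfK n_neq0)).
    rewrite -natrM => /eqP; rewrite eqr_nat => /eqP ->.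
    by split=> //; apply: dvdn_mull.
  case/dvdnP=> k sk; split=> //; exists k.
    (* The quotient [k] is positive because [s] is a successor: [k = 0] would force [s = 0]. *)
    by move: (erefl s); rewrite {1}sk; case: k {sk}.
  by rewrite sE // sk natrM mulfK // pnatr_eq0 -lt0n.
move=> n_gt0.
have n_neq0 : n%:R != 0 :> rat by rewrite pnatr_eq0 -lt0n.
rewrite /s natrD natr_sum mulrDl div1r; congr (_ + _).
rewrite mulr_suml; apply: eq_big_seq => p.
rewrite mem_primes => /and3P[p_pr _ p_n].
have p_neq0 : p%:R != 0 :> rat by rewrite pnatr_eq0 -lt0n prime_gt0.
apply: (mulIf n_neq0); rewrite mulfVK //.
by rewrite -{1}(divnK p_n) natrM mulrCA mulVf ?mulr1.
Qed.

(** If [p ^ 2] divided [n], then [p] would divide both [n %/ p] and [n %/ p - 1], hence 1. *)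
Lemma logn_giuga (n p : nat) : (0 < n)%N -> prime p -> (p %| n)%N ->
  (p%:Z %| (n %/ p)%N%:Z - 1)%Z -> logn p n = 1%N.
Proof.
move=> n_gt0 p_pr p_n H; apply/eqP; rewrite eqn_leq logn_gt0.
rewrite mem_primes p_pr n_gt0 p_n !andbT leqNgt -pfactor_dvdn //.
rewrite expnS expn1; apply/negP => p2_n.
have p_np : (p%:Z %| (n %/ p)%N%:Z)%Z.
  by rewrite dvdzE /= dvdn_divRL.
move: H; rewrite rpredDl // rpredN dvdzE /= dvdn1 => /eqP p1.
by rewrite p1 in p_pr.
Qed.

Lemma giuga_sondowN1 (n : nat) : giuga n <-> composite n /\ sondow (-1) n.
Proof.
split=> -[cn H]; split=> //; have n_gt0 := ltnW cn.1.
  by split=> // p p_pr p_n; rewrite (logn_giuga _ _ _ (H p p_pr p_n)) ?expn1 ?H.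
move=> p p_pr p_n; apply: dvdz_trans (H.2 p p_pr p_n).
(* The exponent [logn p n] is at least 1, so the Sondow modulus is a multiple of [p]. *)
by rewrite dvdzE /= dvdn_exp // logn_gt0 mem_primes p_pr n_gt0.
Qed.

Lemma sondow_one (mu : int) : sondow mu 1.
Proof. by split=> // p p_pr; rewrite dvdn1 => /eqP p1; rewrite p1 in p_pr. Qed.

Lemma sondowN1_prime (p : nat) : prime p -> sondow (-1) p.
Proof.
move=> p_pr; split=> [|q q_pr]; first exact: prime_gt0.
rewrite dvdn_prime2 // => /eqP ->.
by rewrite divnn prime_gt0 // subrr dvdz0.
Qed.

Theorem corollary1 :
  (forall n : nat, (1 < n)%N ->
     (giuga n <-> composite n /\ sondow (-1) n) /\
     (weak_primary_pseudoperfect n <-> sondow 1 n)) /\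
  sondow 1 = weak_primary_pseudoperfect /\
  sondow (-1) = ([set 1%N] `|` prime_numbers `|` giuga)%classic.
Proof.
have wS n : weak_primary_pseudoperfect n <-> sondow 1 n.
  by rewrite weak_primary_pseudoperfect_dvdn sondow1_dvdn.
split=> [n _|]; first by split; [exact: giuga_sondowN1 | exact: wS].
(* Both inclusions of the first equality close here; those for [sondow (-1)] remain. *)
split; apply/seteqP; split=> n; try by move/wS.
  move=> Sn; have [n1|n_neq1] := eqVneq n 1%N; first by left; left.
  have [n_pr|n_npr] := boolP (prime n); first by left; right.
  right; apply/giuga_sondowN1; split=> //; split=> //.
  by rewrite ltn_neqAle eq_sym n_neq1 Sn.1.
case=> [[->|]|/giuga_sondowN1[]//]; first exact: sondow_one.
exact: sondowN1_prime.
Qed.
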